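(* Consider the bipartite pentagon system and let $r_5=\sqrt{\sec(\pi/5)}$ and $$\Phi_H=\begin{pmatrix} -\cos(\pi/5) & \frac{-r_5^6\sin(\pi/5)}{8(1+r_5^2)} & 0\\ \frac{-r_5^6\sin(\pi/5)}{8(1+r_5^2)} & \cos(\pi/5) & \frac{-r_5^3}{4\sin(\pi/5)}\\ 0&\frac{-r_5^3}{4\sin(\pi/5)}&1\end{pmatrix}.$$ For every $\epsilon\in(0,1]$ and every $$\omega_i\otimes\omega_j\in\{\omega_3\otimes\omega_4,\ \omega_3\otimes\omega_5,\ \omega_4\otimes\omega_3,\ \omega_4\otimes\omega_4,\ \omega_5\otimes\omega_3\},$$ the state $W_\epsilon=\epsilon\,\Phi_H+(1-\epsilon)\,\omega_i\otimes\omega_j$ exhibits Hardy-type nonlocality for a suitable choice of measurements, i.e. there are measurements of the type described in the context such that on $W_\epsilon$ $$P(E_1^{A+},E_1^{B+})>0,\quad P(E_1^{A+},E_2^{B+})=0,\quad P(E_2^{A+},E_1^{B+})=0,\quad P(E_2^{A-},E_2^{B-})=0 .$$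
   Context: Pentagon model ($n=5$). The elementary state space is the convex hull in $\mathbb R^3$ of the pure states $\omega_i=(r_5\cos\frac{2\pi i}{5},\,r_5\sin\frac{2\pi i}{5},\,1)^{\mathrm T}$, $i=1,\dots,5$. The unit effect is $u=(0,0,1)^{\mathrm T}$; the probability of an effect $e$ on a state $\omega$ is $e^{\mathrm T}\omega$, and the effects are all $e\in\mathbb R^3$ with $0\le e^{\mathrm T}\omega\le 1$ on all states. The extremal effects other than $0$ and $u$ are $e_i=\frac{1}{1+r_5^2}(r_5\cos\frac{2\pi i}{5},\,r_5\sin\frac{2\pi i}{5},\,1)^{\mathrm T}$ and $\bar e_i=u-e_i$, $i=1,\dots,5$. Bipartite (maximal tensor product) states are the real $3\times3$ matrices $\Phi$ with $u^{\mathrm T}\Phi u=1$ and $e^{\mathrm T}\Phi f\ge 0$ for all effects $e,f$; the product state $\omega_i\otimes\omega_j$ is the matrix $\omega_i\omega_j^{\mathrm T}$. The matrix $\Phi_H$ is such a state. The joint probability of Alice's effect $E$ and Bob's effect $F$ on $\Phi$ is $P(E,F)=E^{\mathrm T}\Phi F$. Measurements used in Hardy's test: Alice has two different measurements $\{E_x^{A+},E_x^{A-}\}$, $x=1,2$, and Bob has two different measurements $\{E_y^{B+},E_y^{B-}\}$, $y=1,2$, each consisting of a pair $\{e_i,\bar e_i\}$ with either effect assigned the label $+$. *)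

(* Defs.v *)
From HB Require Import structures.
From mathcomp Require Import all_boot all_order all_algebra.
From mathcomp Require Import classical_sets reals trigo.

Set Implicit Arguments.
Unset Strict Implicit.
Unset Printing Implicit Defensive.

Import Order.TTheory GRing.Theory Num.Theory.

Local Open Scope ring_scope.
Local Open Scope classical_set_scope.

Section Pentagon.
Variable R : realType.

Definition mx_of_rows m n (s : seq (seq R)) : 'M[R]_(m, n) :=
  \matrix_(i < m, j < n) (nth [::] s i)`_j.

Definition r5 : R := Num.sqrt (cos (pi / 5))^-1.

(* Vertex labels are natural numbers, meaningful in the range 1, ..., 5. *)
Definition pure_state (i : nat) : 'cV[R]_3 :=
  mx_of_rows 3 1 [:: [:: r5 * cos (2 * pi * i%:R / 5)];
                     [:: r5 * sin (2 * pi * i%:R / 5)];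
                     [:: 1]].

Definition state_space : set 'cV[R]_3 :=
  [set w | exists p : nat -> R,
     [/\ forall i, 0 <= p i,
         \sum_(1 <= i < 6) p i = 1 &
         w = \sum_(1 <= i < 6) p i *: pure_state i]].

Definition unit_effect : 'cV[R]_3 :=
  mx_of_rows 3 1 [:: [:: 0]; [:: 0]; [:: 1]].

Definition prob (e w : 'cV[R]_3) : R := (e^T *m w) 0 0.

Definition effects : set 'cV[R]_3 :=
  [set e | forall w, state_space w -> 0 <= prob e w <= 1].

Definition ray_effect (i : nat) : 'cV[R]_3 :=
  (1 + r5 ^+ 2)^-1 *: pure_state i.

Definition coray_effect (i : nat) : 'cV[R]_3 := unit_effect - ray_effect i.

Definition joint_prob (Phi : 'M[R]_3) (E F : 'cV[R]_3) : R :=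
  (E^T *m Phi *m F) 0 0.

Definition bipartite_states : set 'M[R]_3 :=
  [set Phi | joint_prob Phi unit_effect unit_effect = 1 /\
     forall e f, effects e -> effects f -> 0 <= joint_prob Phi e f].

Definition product_state (i j : nat) : 'M[R]_3 :=
  pure_state i *m (pure_state j)^T.

Record measurement := Measurement {
  plus_effect : 'cV[R]_3;
  minus_effect : 'cV[R]_3
}.

Definition effect_pair (M : measurement) : set 'cV[R]_3 :=
  [set plus_effect M; minus_effect M].

Definition pentagon_measurement (M : measurement) : Prop :=
  exists2 i : nat, (1 <= i <= 5)%N &
    M = Measurement (ray_effect i) (coray_effect i) \/
    M = Measurement (coray_effect i) (ray_effect i).

(* Two measurements are different when their unlabelled pairs of effects
   differ: exchanging the labels does not give a different measurement. *)
Definition hardy_measurements (M1 M2 : measurement) : Prop :=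
  [/\ pentagon_measurement M1, pentagon_measurement M2 &
      effect_pair M1 <> effect_pair M2].

Definition hardy_nonlocal (Phi : 'M[R]_3) : Prop :=
  exists A1 A2 B1 B2 : measurement,
    [/\ hardy_measurements A1 A2, hardy_measurements B1 B2 &
    [/\ 0 < joint_prob Phi (plus_effect A1) (plus_effect B1),
        joint_prob Phi (plus_effect A1) (plus_effect B2) = 0,
        joint_prob Phi (plus_effect A2) (plus_effect B1) = 0 &
        joint_prob Phi (minus_effect A2) (minus_effect B2) = 0]].

Definition Phi_H : 'M[R]_3 :=
  let a := - r5 ^+ 6 * sin (pi / 5) / (8 * (1 + r5 ^+ 2)) in
  let b := - r5 ^+ 3 / (4 * sin (pi / 5)) in
  mx_of_rows 3 3 [:: [:: - cos (pi / 5); a; 0];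
                     [:: a; cos (pi / 5); b];
                     [:: 0; b; 1]].

End Pentagon.

(* Main.v *)
(** In the coordinates (r_5 x, r_5 sin(pi/5) y, z), the pure states, the
    pairing of effects with states and the bilinear form of Phi_H all have
    coefficients in Q(sqrt 5) = Q(g), with g = 2 cos(pi/5) the golden ratio, so
    every probability reduces to the form a + b g by g^2 = g + 1.  Every effect
    lies in the cone spanned by the five vertices (the pentagon is self-dual);
    hence Phi_H is a state as soon as its 25 values on pairs of vertices are
    nonnegative.  For Hardy's test take + effects e_1, e_5 for Alice and e_1,
    1 - e_2 for Bob when i = 3, and exchange the two parties otherwise.  The
    product state then satisfies the three zero conditions, and contributes
    nothing to P(e_1, e_1) because e_1 vanishes on the vertices 3 and 4. *)

Require Import Defs.
From mathcomp Require Import all_boot all_order all_algebra.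
From mathcomp Require Import classical_sets reals trigo.
From mathcomp Require Import ring lra.

Import Order.TTheory GRing.Theory Num.Theory.
Local Open Scope ring_scope.

(** * Golden ratio and rescaled coordinates *)

Definition golden (R : realType) : R := 2 * cos (pi / 5).

Definition vec {R : realType} (x y z : R) : 'cV[R]_3 :=
  mx_of_rows 3 1 [:: [:: r5 R * x]; [:: r5 R * (sin (pi / 5) * y)]; [:: z]].

(** Entry 0 repeats vertex 5, so the labels 1 to 5 index the list directly. *)
Definition vertex_x (R : realType) (i : nat) : R :=
  let g := golden R in
  [:: 1; (g - 1) / 2; - g / 2; - g / 2; (g - 1) / 2; 1]`_i.

Definition vertex_y (R : realType) (i : nat) : R :=
  let g := golden R in [:: 0; g; 1; - 1; - g; 0]`_i.

Section Golden.
Variable R : realType.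
Local Notation g := (golden R).
Local Notation s := (sin (pi / 5) : R).

Lemma pi5_bounds : 0 < (pi / 5 : R) < pi / 2.
Proof. have := @pi_gt0 R; lra. Qed.

Lemma sin_pi5_gt0 : 0 < s.
Proof. exact/sin_gt0_pihalf/pi5_bounds. Qed.

Lemma cos_pi5_gt0 : 0 < (cos (pi / 5) : R).
Proof. apply: cos_gt0_pihalf; have := pi5_bounds; lra. Qed.

Lemma cos_multiples_pi5 :
  let c := cos (pi / 5) : R in
  [/\ cos (pi / 5 *+ 2) = c ^+ 2 *+ 2 - 1 :> R,
      sin (pi / 5 *+ 2) = (c * s) *+ 2 :> R &
      4 * c ^+ 2 = 2 * c + 1].
Proof.
move=> c; have c2 := cos_mulr2n (pi / 5 : R); have s2 := sin_mulr2n (pi / 5 : R).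
split=> //.
(* cos (3t) = - cos (2t) for t = pi/5; the factor c + 1 is spurious *)
have e : pi / 5 *+ 2 + pi / 5 = pi - pi / 5 *+ 2 :> R by field.
have := cosD (pi / 5 *+ 2) (pi / 5 : R).
rewrite e cosB cospi sinpi c2 s2 -/c => h.
have c0 : 0 < c := cos_pi5_gt0.
have s2E : s ^+ 2 = 1 - c ^+ 2 := sin2cos2 _.
have : (c + 1) * (4 * c ^+ 2 - (2 * c + 1)) = 0.
  have h' : c * s *+ 2 * s = 2 * c * s ^+ 2 by ring.
  by rewrite h' s2E in h; lra.
by move/eqP; rewrite mulf_eq0 gt_eqF ?addr_gt0 //= subr_eq0 => /eqP.
Qed.

Lemma golden_sqr : g ^+ 2 = g + 1.
Proof. case: cos_multiples_pi5 => _ _ h; rewrite /golden; lra. Qed.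

Lemma golden_bounds : 8 / 5 < g < 17 / 10.
Proof.
have := golden_sqr; have : 0 < g by rewrite mulr_gt0 ?cos_pi5_gt0.
move=> g0 g2; apply/andP; split; nra.
Qed.

Lemma sqr_sin_pi5 : s ^+ 2 = (3 - g) / 4.
Proof.
have := golden_sqr; rewrite sin2cos2 /golden; lra.
Qed.

(** The secant of $\pi/5$ is $2/g$, and $g^2 = g + 1$ gives $1/g = g - 1$. *)
Lemma sqr_r5 : r5 R ^+ 2 = 2 * (g - 1).
Proof.
rewrite sqr_sqrtr ?invr_ge0 ?ltW ?cos_pi5_gt0 //.
have c0 := cos_pi5_gt0; have := golden_sqr; rewrite /golden => h.
apply: (mulfI (lt0r_neq0 c0)); rewrite divff ?lt0r_neq0 //; lra.
Qed.

Lemma r5_gt0 : 0 < r5 R.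
Proof. by rewrite sqrtr_gt0 invr_gt0 cos_pi5_gt0. Qed.

Lemma pure_stateE i : (1 <= i <= 5)%N ->
  pure_state R i = vec (vertex_x R i) (vertex_y R i) 1.
Proof.
case: cos_multiples_pi5 => c2 s2 _; have g2 := golden_sqr.
set t : R := pi / 5 in c2 s2 *.
have cx : cos t = g / 2 by rewrite /golden; field.
have cos2t : cos (t *+ 2) = (g - 1) / 2 by rewrite c2 cx; lra.
have sin2t : sin (t *+ 2) = sin t * g by rewrite s2 cx; field.
suff H : (1 <= i <= 5)%N -> cos (2 * pi * i%:R / 5) = vertex_x R i /\
    sin (2 * pi * i%:R / 5) = sin t * vertex_y R i.
  by move=> /H[hx hy]; rewrite /pure_state /vec hx hy.
case: i => [|[|[|[|[|[|]]]]]] //= _; rewrite /vertex_x /vertex_y /=.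
- by rewrite (_ : _ / 5 = t *+ 2); [|rewrite /t; field].
- rewrite (_ : _ / 5 = pi - t); last by rewrite /t; field.
  rewrite cosB sinB cospi sinpi cx; split; [by field|by field].
- rewrite (_ : _ / 5 = t + pi); last by rewrite /t; field.
  rewrite cosDpi sinDpi cx; split; [by field|by field].
- rewrite (_ : _ / 5 = - (t *+ 2) + pi *+ 2); last by rewrite /t; field.
  by rewrite cosD2pi sinD2pi cosN sinN cos2t sin2t; split; ring.
- rewrite (_ : _ / 5 = pi *+ 2); last by field.
  by rewrite cos2pi sin2pi mulr0.
Qed.

(** * Pairings in the rescaled coordinates *)

Lemma unit_effectE : unit_effect R = vec 0 0 1.
Proof. by rewrite /unit_effect /vec !mulr0. Qed.

Lemma vecD (x y z x' y' z' : R) :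
  vec x y z + vec x' y' z' = vec (x + x') (y + y') (z + z').
Proof.
by apply/matrixP => -[[|[|[|]]] //= ?] j; rewrite !mxE ord1 /= ?mulrDr.
Qed.

Lemma vecZ (a x y z : R) : a *: vec x y z = vec (a * x) (a * y) (a * z).
Proof.
by apply/matrixP => -[[|[|[|]]] //= ?] j; rewrite !mxE ord1 //=; ring.
Qed.

Lemma vecP (e : 'cV[R]_3) : exists x y z, e = vec x y z.
Proof.
have r0 := lt0r_neq0 r5_gt0; have s0 := lt0r_neq0 sin_pi5_gt0.
exists (e 0 0 / r5 R), (e 1 0 / (r5 R * s)), (e (inord 2) 0).
apply/matrixP => -[[|[|[|]]] //= hi] j; rewrite !mxE ord1 /=.
- by rewrite mulrC divfK //; congr (e _ _); apply/val_inj.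
- rewrite (_ : r5 R * _ = e 1 0); last by field; rewrite r0 s0.
  by congr (e _ _); apply/val_inj.
- by congr (e _ _); apply/val_inj; rewrite /= inordK.
Qed.

Lemma prob_vec (x y z x' y' z' : R) :
  prob (vec x y z) (vec x' y' z') =
  2 * (g - 1) * (x * x') + (3 * g - 4) / 2 * (y * y') + z * z'.
Proof.
rewrite /prob !mxE !big_ord_recl big_ord0 !mxE /=.
have r2 := sqr_r5; have s2 := sqr_sin_pi5; have g2 := golden_sqr.
transitivity (r5 R ^+ 2 * (x * x' + s ^+ 2 * (y * y')) + z * z').
  by ring.
by rewrite r2 s2; field: g2.
Qed.

Lemma joint_prob_PhiH_vec (x y z x' y' z' : R) :
  joint_prob (Phi_H R) (vec x y z) (vec x' y' z') =
  z * z' - x * x' + (3 - g) / 4 * (y * y')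
  - (5 * g - 8) / 2 * (x * y' + y * x') - (2 - g) * (y * z' + z * y').
Proof.
rewrite /joint_prob !mxE !big_ord_recl big_ord0 !mxE.
rewrite !big_ord_recl !big_ord0 !mxE /=.
have r2 := sqr_r5; have s2 := sqr_sin_pi5; have g2 := golden_sqr.
have s0 := lt0r_neq0 sin_pi5_gt0; have gb := golden_bounds.
have g1 : 2 * g - 1 != 0 by apply: lt0r_neq0; lra.
set a := - r5 R ^+ 6 * s / _; set b := - r5 R ^+ 3 / _.
(* Here [a] is $-s(g-1)^3/(2g-1)$, with $(g-1)^3 = 2g-3$; since $(2g-1)^2 = 5$, dividing by $2g-1$
   is multiplying by $(2g-1)/5$. *)
have aE : a = - s * ((7 - 4 * g) / 5).
  rewrite /a (exprM _ 2 3) r2.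
  rewrite (_ : 1 + 2 * (g - 1) = 2 * g - 1); last by ring.
  by field: g2.
have bE : b * s = - r5 R * (g - 1) / 2.
  by rewrite /b exprS r2; field.
have cE : cos (pi / 5) = g / 2 by rewrite /golden; field.
(* In this grouping [b] occurs only as [b * s], which cancels its denominator, and after
   substitution [r5 R] and [s] occur only squared. *)
transitivity (r5 R ^+ 2 * (s ^+ 2 * cos (pi / 5) * (y * y')
  - cos (pi / 5) * (x * x')) + r5 R ^+ 2 * (a * s) * (x * y' + y * x')
  + r5 R * (b * s) * (y * z' + z * y') + z * z').
  by ring.
rewrite bE aE cE.
transitivity (r5 R ^+ 2 * (s ^+ 2 * (g / 2) * (y * y') - g / 2 * (x * x'))
  - r5 R ^+ 2 * s ^+ 2 * ((7 - 4 * g) / 5) * (x * y' + y * x')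
  - r5 R ^+ 2 * ((g - 1) / 2) * (y * z' + z * y') + z * z').
  by field.
by rewrite r2 s2; field: g2.
Qed.

(** * Self-duality of the pentagon *)

Lemma pure_state_in_space i : (1 <= i <= 5)%N -> state_space (pure_state R i).
Proof.
move=> hi; exists (fun k => (k == i)%:R); split=> [k||]; first exact: ler0n.
- rewrite (bigD1_seq i) ?mem_index_iota ?iota_uniq //= eqxx big1 ?addr0 //.
  by move=> k /negPf ->.
- rewrite (bigD1_seq i) ?mem_index_iota ?iota_uniq //= eqxx scale1r.
  by rewrite big1 ?addr0 // => k /negPf ->; rewrite scale0r.
Qed.

Lemma prob_pure_ge0 e i : (1 <= i <= 5)%N -> effects e ->
  0 <= prob e (pure_state R i).
Proof. by move=> /pure_state_in_space hi /(_ _ hi)/andP[]. Qed.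

(** Without such a descent around the cycle, all five numbers would share one strict sign. This
    locates the sector containing a point. *)
Lemma sign_change (s1 s2 s3 s4 s5 : R) : s1 + s2 + s3 + s4 + s5 = 0 ->
  [\/ 0 <= s1 /\ s2 <= 0, 0 <= s2 /\ s3 <= 0, 0 <= s3 /\ s4 <= 0
    | 0 <= s4 /\ s5 <= 0] \/ (0 <= s5 /\ s1 <= 0).
Proof.
move=> h.
case: (lerP 0 s1) (lerP 0 s2) (lerP 0 s3) (lerP 0 s4) (lerP 0 s5) =>
  h1 [] h2 [] h3 [] h4 [] h5;
  first [by right; split; lra | left; first
   [ by constructor 1; split; lra | by constructor 2; split; lra
   | by constructor 3; split; lra | by constructor 4; split; lra ] | exfalso; lra].
Qed.

(** Self-duality as an induction principle, so that a bilinear positivity claim can be reduced to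
    vertices one argument at a time. *)
Lemma effects_ind (P : 'cV[R]_3 -> Prop) :
  (forall a e, 0 <= a -> P e -> P (a *: e)) ->
  (forall e f, P e -> P f -> P (e + f)) ->
  (forall i, (1 <= i <= 5)%N -> P (pure_state R i)) ->
  forall e, effects e -> P e.
Proof.
move=> PZ PD Pw e he.
have g2 := golden_sqr; have gb := golden_bounds.
have Pv i : (1 <= i <= 5)%N -> P (vec (vertex_x R i) (vertex_y R i) 1).
  by move=> hi; rewrite -pure_stateE //; exact: Pw.
(* The unit effect is the barycentre of the vertices. *)
have Pu : P (vec 0 0 1).
  have -> : vec 0 0 1 = 5^-1 *: (vec (vertex_x R 1) (vertex_y R 1) 1
    + vec (vertex_x R 2) (vertex_y R 2) 1 + vec (vertex_x R 3) (vertex_y R 3) 1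
    + vec (vertex_x R 4) (vertex_y R 4) 1 + vec (vertex_x R 5) (vertex_y R 5) 1).
    by rewrite !vecD vecZ /vertex_x /vertex_y /=; congr vec; field.
  apply: (PZ); first by rewrite invr_ge0.
  by do 4 (apply: (PD); last exact: Pv); exact: Pv.
have hp i : (1 <= i <= 5)%N -> 0 <= prob e (vec (vertex_x R i) (vertex_y R i) 1).
  by move=> hi; rewrite -pure_stateE //; exact: prob_pure_ge0.
have [x [y [z eE]]] := vecP e; rewrite {}eE in hp *.
(* (x, y) lies in the sector of some edge [i, j] of the pentagon; subtracting
   its component along that edge leaves a multiple of the unit effect, whose
   coefficient is read off at the vertex k opposite to the edge, where both
   e_i and e_j vanish *)
pose d i := vertex_x R i * y - vertex_y R i * x.
(* The coefficients come from Cramer's rule: consecutive vertices have determinant $g$, whose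
   inverse is $g - 1$. *)
have key i j k : (1 <= i <= 5)%N -> (1 <= j <= 5)%N -> (1 <= k <= 5)%N ->
    0 <= d i -> d j <= 0 ->
    vec x y z = ((g - 1) * - d j) *: vec (vertex_x R i) (vertex_y R i) 1
      + ((g - 1) * d i) *: vec (vertex_x R j) (vertex_y R j) 1
      + prob (vec x y z) (vec (vertex_x R k) (vertex_y R k) 1) *: vec 0 0 1 ->
    P (vec x y z).
  move=> hi hj hk di dj ->; have g1 : 0 <= g - 1 by lra.
  have dj' : 0 <= - d j by rewrite oppr_ge0.
  apply: (PD); first by apply: (PD); apply: (PZ); [exact: mulr_ge0|exact: Pv
    |exact: mulr_ge0|exact: Pv].
  exact: PZ (hp _ hk) Pu.
(* [d] is linear in the vertex, and the planar parts of the vertices sum to zero. *)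
have sd : d 1%N + d 2%N + d 3%N + d 4%N + d 5%N = 0.
  by rewrite /d /vertex_x /vertex_y /=; field.
case: (sign_change _ _ _ _ _ sd) => [[]|] [h1 h2];
  [apply: (key 1 2 4)%N|apply: (key 2 3 5)%N|apply: (key 3 4 1)%N
  |apply: (key 4 5 2)%N|apply: (key 5 1 3)%N] => //;
  rewrite prob_vec !vecZ !vecD /d /vertex_x /vertex_y /=;
  by congr vec; field: g2.
Qed.

(** * Bilinearity and positivity of joint probabilities *)

Lemma joint_probDl Phi (e e' f : 'cV[R]_3) :
  joint_prob Phi (e + e') f = joint_prob Phi e f + joint_prob Phi e' f.
Proof. by rewrite /joint_prob linearD /= !mulmxDl mxE. Qed.

Lemma joint_probZl Phi a (e f : 'cV[R]_3) :
  joint_prob Phi (a *: e) f = a * joint_prob Phi e f.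
Proof. by rewrite /joint_prob linearZ /= -!scalemxAl mxE. Qed.

Lemma joint_probDr Phi (e f f' : 'cV[R]_3) :
  joint_prob Phi e (f + f') = joint_prob Phi e f + joint_prob Phi e f'.
Proof. by rewrite /joint_prob mulmxDr mxE. Qed.

Lemma joint_probZr Phi a (e f : 'cV[R]_3) :
  joint_prob Phi e (a *: f) = a * joint_prob Phi e f.
Proof. by rewrite /joint_prob -scalemxAr mxE. Qed.

Lemma joint_prob_mix Phi a b i j (e f : 'cV[R]_3) :
  joint_prob (a *: Phi + b *: product_state R i j) e f =
  a * joint_prob Phi e f
  + b * (prob e (pure_state R i) * prob f (pure_state R j)).
Proof.
rewrite /joint_prob /prob /product_state mulmxDr mulmxDl -!scalemxAr -!scalemxAl.
rewrite mxE [X in X + _]mxE [X in _ + X]mxE; congr (_ + _ * _).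
set v := pure_state R i; set w := pure_state R j.
have -> : e^T *m (v *m w^T) *m f = (e^T *m v) *m (f^T *m w)^T.
  by rewrite trmx_mul trmxK !mulmxA.
by rewrite [LHS]mxE big_ord1 [X in _ * X]mxE.
Qed.

(** Sign checks are linear once the powers of [g] count as unknowns, so each power needs its own
    relation. *)
Lemma golden_cube : g ^+ 3 = 2 * g + 1.
Proof. by rewrite exprS golden_sqr; ring: golden_sqr. Qed.

Lemma joint_prob_PhiH_pure_ge0 i j : (1 <= i <= 5)%N -> (1 <= j <= 5)%N ->
  0 <= joint_prob (Phi_H R) (pure_state R i) (pure_state R j).
Proof.
move=> hi hj; rewrite !pure_stateE // joint_prob_PhiH_vec /vertex_x /vertex_y.
have g2 := golden_sqr; have g3 := golden_cube; have gb := golden_bounds.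
case: i hi => [|[|[|[|[|[|]]]]]] //= _;
  by case: j hj => [|[|[|[|[|[|]]]]]] //= _; lra.
Qed.

Lemma joint_prob_PhiH_ge0 e f : effects e -> effects f ->
  0 <= joint_prob (Phi_H R) e f.
Proof.
move=> he hf; elim/effects_ind: he => [a e' a0 h|e1 e2 h1 h2|i hi].
- by rewrite joint_probZl mulr_ge0.
- by rewrite joint_probDl addr_ge0.
elim/effects_ind: hf => [a e' a0 h|e1 e2 h1 h2|j hj].
- by rewrite joint_probZr mulr_ge0.
- by rewrite joint_probDr addr_ge0.
exact: joint_prob_PhiH_pure_ge0.
Qed.

(** * Effects and measurements for Hardy's test *)

(** The normalisation [q] is $1/(2g-1) = 1/\sqrt5$. *)
Lemma ray_effectE i : (1 <= i <= 5)%N -> let q := (2 * g - 1) / 5 in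
  ray_effect R i = vec (q * vertex_x R i) (q * vertex_y R i) q.
Proof.
move=> hi q; rewrite /ray_effect pure_stateE // vecZ mulr1.
suff -> : (1 + r5 R ^+ 2)^-1 = q by [].
have gb := golden_bounds; have g2 := golden_sqr; rewrite sqr_r5.
have h : 1 + 2 * (g - 1) != 0 by apply: lt0r_neq0; lra.
by apply: (mulfI h); rewrite divff // /q; field: g2.
Qed.

Lemma coray_effectE i : (1 <= i <= 5)%N -> let q := (2 * g - 1) / 5 in
  coray_effect R i = vec (- (q * vertex_x R i)) (- (q * vertex_y R i)) (1 - q).
Proof.
move=> hi q; rewrite /coray_effect ray_effectE // unit_effectE -scaleN1r.
by rewrite vecZ vecD !add0r !mulN1r.
Qed.

Definition ray_measurement i : measurement R :=
  Measurement (ray_effect R i) (coray_effect R i).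

Definition coray_measurement i : measurement R :=
  Measurement (coray_effect R i) (ray_effect R i).

(** At vertex 1, $e_1$ has probability $1$, its neighbours $e_2$ and $e_5$ have $g-1$, and their
    complements $2-g$. Hence $e_1$ separates the unlabelled pairs. *)
Lemma ray_effect1_neq i : (i == 2%N) || (i == 5%N) ->
  ray_effect R 1 <> ray_effect R i /\ ray_effect R 1 <> coray_effect R i.
Proof.
have g2 := golden_sqr; have g3 := golden_cube; have gb := golden_bounds.
have g4 : g ^+ 4 = 3 * g + 2 by rewrite exprS g3; ring: g2.
by case/orP => /eqP ->; split => /(congr1 (fun e => prob e (pure_state R 1)));
  rewrite ?coray_effectE // !ray_effectE // pure_stateE // !prob_vec
    /vertex_x /vertex_y /= => h; lra.
Qed.

Lemma hardy_measurements_15 :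
  hardy_measurements (ray_measurement 1) (ray_measurement 5).
Proof.
split; [by exists 1%N => //; left|by exists 5%N => //; left|] => h.
have [n1 n2] := ray_effect1_neq 5 isT.
have : effect_pair (ray_measurement 1) (ray_effect R 1) by left.
by rewrite h => -[].
Qed.

Lemma hardy_measurements_12 :
  hardy_measurements (ray_measurement 1) (coray_measurement 2).
Proof.
split; [by exists 1%N => //; left|by exists 2%N => //; right|] => h.
have [n1 n2] := ray_effect1_neq 2 isT.
have : effect_pair (ray_measurement 1) (ray_effect R 1) by left.
by rewrite h => -[].
Qed.
End Golden.

Theorem theorem5 (R : realType) (eps : R) (i j : nat)
  (heps : 0 < eps <= 1)
  (hij : (i, j) \in [:: (3, 4); (3, 5); (4, 3); (4, 4); (5, 3)]%N) :
  let W := eps *: Phi_H R + (1 - eps) *: product_state R i j in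
  bipartite_states W /\ hardy_nonlocal W.
Proof.
move=> W.
have [hi hj] : (1 <= i <= 5)%N /\ (1 <= j <= 5)%N.
  by move: hij; rewrite !inE !xpair_eqE => /or4P[|||/orP[]] /andP[/eqP-> /eqP->].
have /andP[eps0 eps1] := heps.
split; [split=> [|e f he hf]|].
- rewrite joint_prob_mix !pure_stateE // unit_effectE joint_prob_PhiH_vec.
  by rewrite !prob_vec; field.
- rewrite joint_prob_mix; have p1 := prob_pure_ge0 _ _ _ hi he.
  have p2 := prob_pure_ge0 _ _ _ hj hf.
  have p3 := joint_prob_PhiH_ge0 _ _ _ he hf.
  by rewrite addr_ge0 ?mulr_ge0 ?subr_ge0 // ltW.
have g2 := golden_sqr R; have g3 := golden_cube R; have gb := golden_bounds R.
have [q [qE q0]] : exists q, q = (2 * golden R - 1) / 5 /\ 0 < q.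
  by exists ((2 * golden R - 1) / 5); split=> //; lra.
have pos : 0 < joint_prob W (ray_effect R 1) (ray_effect R 1).
  (* The factor $7-4g$ is the value of [Phi_H] at the vertex pair (1, 1), positive because $g <
     17/10$. *)
  have -> : joint_prob W (ray_effect R 1) (ray_effect R 1)
      = eps * (q ^+ 2 * (7 - 4 * golden R)).
    rewrite joint_prob_mix !pure_stateE // !ray_effectE // -!qE !prob_vec.
    rewrite joint_prob_PhiH_vec; move: hij; rewrite !inE !xpair_eqE.
    by case/or4P => [|||/orP[]] /andP[/eqP-> /eqP->];
      rewrite /vertex_x /vertex_y /=; field: g2.
  by rewrite !mulr_gt0 ?exprn_gt0 //; lra.
have : ((i, j) \in [:: (3, 4); (3, 5)]%N) ||
    ((i, j) \in [:: (4, 3); (4, 4); (5, 3)]%N).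
  by rewrite -mem_cat.
case/orP=> {}hij.
  (* On the product state, $e_1$ and $e_5$ vanish at Alice's vertex 3, and $e_2$ at Bob's vertices 4
     and 5. *)
  exists (ray_measurement R 1), (ray_measurement R 5),
    (ray_measurement R 1), (coray_measurement R 2).
  split; [exact: hardy_measurements_15|exact: hardy_measurements_12|].
  split=> //=; rewrite joint_prob_mix !pure_stateE // ?coray_effectE //
    ?ray_effectE // !prob_vec joint_prob_PhiH_vec; move: hij;
    rewrite !inE !xpair_eqE => /orP[] /andP[/eqP-> /eqP->];
    by rewrite /vertex_x /vertex_y /=; field: g2.
(* On the product state, $e_2$ vanishes at Alice's vertices 4 and 5, and $e_1$ at Bob's 3 and 4. For
   $P(e_1, e_5)$, either $e_1$ vanishes at Alice's vertex 4 or $e_5$ at Bob's vertex 3. *)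
exists (ray_measurement R 1), (coray_measurement R 2),
  (ray_measurement R 1), (ray_measurement R 5).
split; [exact: hardy_measurements_12|exact: hardy_measurements_15|].
split=> //=; rewrite joint_prob_mix !pure_stateE // ?coray_effectE //
  ?ray_effectE // !prob_vec joint_prob_PhiH_vec; move: hij;
  rewrite !inE !xpair_eqE => /or3P[] /andP[/eqP-> /eqP->];
  by rewrite /vertex_x /vertex_y /=; field: g2.
Qed.
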